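(* Fix distinct real numbers $a_1,\dots,a_m>0$ and let $A=(a_1,\dots,a_m)$. For $n\ge 1$ let $\mathcal{C}_{n-1}=\mathcal{C}_{n-1}(A)$ be the arrangement in $V_{n-1}=\{x\in\mathbb{R}^n: x_1+\cdots+x_n=0\}$ consisting of the hyperplanes $x_i-x_j=a_s$ for all ordered pairs $i\ne j$ in $\{1,\dots,n\}$ and all $s=1,\dots,m$, and let $\mathcal{C}^0_{n-1}$ be obtained from $\mathcal{C}_{n-1}$ by adjoining the hyperplanes $x_i=x_j$, $i\neq j$. Let $r(\cdot)$ denote the number of regions, with $r(\mathcal{C}_{-1})=r(\mathcal{C}^0_{-1})=1$, and let $$f_A(t)=\sum_{n\ge 0} r(\mathcal{C}_{n-1})\frac{t^n}{n!},\qquad g_A(t)=\sum_{n\ge0} r(\mathcal{C}^0_{n-1})\frac{t^n}{n!}.$$ Then $f_A(t)=g_A(1-e^{-t})$; equivalently, $$r(\mathcal{C}^0_{n-1})=\sum_{k\ge 0} c(n,k)\, r(\mathcal{C}_{k-1}),$$ where $c(n,k)$ is the number of permutations of $\{1,\dots,n\}$ with $k$ cycles.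
   Context: A region of a finite hyperplane arrangement is a connected component of the complement of the union of its hyperplanes. *)

(* Defs.v *)
From HB Require Import structures.
From mathcomp Require Import all_boot all_order all_algebra all_fingroup finmap ring lra.
From mathcomp Require Import all_classical all_reals all_analysis.

Set Implicit Arguments.
Unset Strict Implicit.
Unset Printing Implicit Defensive.

Import Order.TTheory GRing.Theory Num.Theory.
Import numFieldNormedType.Exports.

Local Open Scope classical_set_scope.
Local Open Scope ring_scope.

(* An arrangement in the subspace V of R^n is the set of its hyperplanes, each
   one a subset of V. *)
Section Regions.
Variables (R : realType) (n : nat).
Implicit Types (V : set 'rV[R]_n) (C : set (set 'rV[R]_n)).

Definition arr_compl V C : set 'rV[R]_n := V `\` \bigcup_(H in C) H.

(* Connectedness is intrinsic, so it does not matter that these components are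
   taken for the topology of R^n and not for the induced topology of V. *)
Definition regions V C : set (set 'rV[R]_n) :=
  [set connected_component (arr_compl V C) x | x in arr_compl V C].

(* fset_set is fset0 on infinite sets; see finite_regions_catalan and
   finite_regions_catalan0 below. *)
Definition num_regions V C : nat := #|` fset_set (regions V C)|%fset.

End Regions.

Section CatalanArrangements.
Variables (R : realType) (m : nat) (a : 'I_m -> R) (n : nat).

(* The space V_{n-1}, of dimension n - 1 for n >= 1. *)
Definition sum0_space : set 'rV[R]_n := [set x | \sum_(i < n) x 0 i = 0].

Definition diff_hyperplane (i j : 'I_n) (c : R) : set 'rV[R]_n :=
  [set x | sum0_space x /\ x 0 i - x 0 j = c].

Definition catalan : set (set 'rV[R]_n) :=
  [set H | exists (i j : 'I_n) (s : 'I_m),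
     i != j /\ H = diff_hyperplane i j (a s)].

Definition catalan0 : set (set 'rV[R]_n) :=
  catalan `|` [set H | exists i j : 'I_n, i != j /\ H = diff_hyperplane i j 0].

End CatalanArrangements.

(* r_catalan a n is r(C_{n-1}) and r_catalan0 a n is r(C^0_{n-1}). *)
Definition r_catalan (R : realType) (m : nat) (a : 'I_m -> R) (n : nat) : nat :=
  if n is 0%N then 1%N else num_regions (@sum0_space R n) (@catalan R m a n).

Definition r_catalan0 (R : realType) (m : nat) (a : 'I_m -> R) (n : nat) : nat :=
  if n is 0%N then 1%N else num_regions (@sum0_space R n) (@catalan0 R m a n).

(* c(n,k): all cycles count, fixed points included, so c(n,k) = 0 for k > n. *)
Definition stirling1 (n k : nat) : nat :=
  #|[set s : 'S_n | #|porbits s| == k]%SET|.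

(* Formal power series over rat, given by their coefficient sequences. *)
Definition fps := nat -> rat.

Definition fps_one : fps := fun n => (n == 0%N)%:R.

Definition fps_sub (p q : fps) : fps := fun n => p n - q n.

Definition fps_mul (p q : fps) : fps :=
  fun n => \sum_(i < n.+1) p i * q (n - i)%N.

Definition fps_exp (p : fps) (k : nat) : fps := iter k (fps_mul p) fps_one.

(* The substitution p(q(t)) for q with zero constant term: then q^k has no term
   of degree < k, so the coefficient of t^n only involves q^0, ..., q^n. *)
Definition fps_comp (p q : fps) : fps :=
  fun n => \sum_(k < n.+1) p k * fps_exp q k n.

Definition egf (u : nat -> nat) : fps := fun n => (u n)%:R / (n`!)%:R.

(* e^{-t} *)
Definition fps_expN : fps := fun n => (-1) ^+ n / (n`!)%:R.

Section Finiteness.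
Variables (R : realType) (n : nat).
Implicit Types (V X : set 'rV[R]_n.+1) (x y : 'rV[R]_n.+1).

Lemma segment_neq (t p q c : R) : 0 <= t -> t <= 1 -> p <> c -> q <> c ->
  (p < c) = (q < c) -> p + t * (q - p) <> c.
Proof.
move=> t0 t1 /eqP pc /eqP qc pq e; move: pc qc pq.
have [t_lt1|t_ge1] := ltP t 1; last first.
  have e1 : t = 1 by apply/eqP; rewrite eq_le t1.
  by rewrite e1 mul1r addrC subrK in e; rewrite e eqxx.
have s0 : 0 < 1 - t by rewrite subr_gt0.
case: ltgtP => // hp _; case: ltgtP => // hq _ _.
- have h1 : 0 < (1 - t) * (c - p) by rewrite mulr_gt0 // subr_gt0.
  have h2 : 0 <= t * (c - q) by rewrite mulr_ge0 // subr_ge0 ltW.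
  lra.
- have h1 : 0 < (1 - t) * (p - c) by rewrite mulr_gt0 // subr_gt0.
  have h2 : 0 <= t * (q - c) by rewrite mulr_ge0 // subr_ge0 ltW.
  lra.
Qed.

Lemma segment_component X x y :
  (forall t : R, 0 <= t <= 1 -> X (x + t *: (y - x))) ->
  connected_component X x = connected_component X y.
Proof.
move=> Xs; apply: same_connected_component.
exists ((fun t : R => x + t *: (y - x)) @` `[0, 1]); last first.
  by exists 1; rewrite ?scale1r ?subrKC //= in_itv /= ler01 lexx.
split.
- by exists 0; rewrite ?scale0r ?addr0 //= in_itv /= ler01 lexx.
- by move=> _ [t t01 <-]; apply: Xs; move: t01; rewrite /= in_itv.
- apply: connected_continuous_connected; first exact: segment_connected.
  apply: continuous_subspaceT => t; apply: cvgD; first exact: cvg_cst.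
  by apply: cvgZr_tmp; exact: cvg_id.
Qed.

Lemma finite_regions_diff (K : finType) (c : K -> R)
    (C : set (set 'rV[R]_n.+1)) :
  (forall H, C H <-> exists (i j : 'I_n.+1) (k : K),
     i != j /\ H = diff_hyperplane i j (c k)) ->
  finite_set (regions (@sum0_space R n.+1) C).
Proof.
move=> CP; set V := @sum0_space R n.+1; set X := arr_compl V C.
have XP x : X x <-> V x /\ forall i j k, i != j -> x 0 i - x 0 j <> c k.
  split=> [[Vx nCx]|[Vx nx]]; split=> //.
  - move=> i j k ij xij; apply: nCx; exists (diff_hyperplane i j (c k)) => //.
    by apply/CP; exists i, j, k.
  - by move=> [H /CP[i [j [k [ij ->]]]] [_ /nx]]; exact.
pose sg x := [ffun t : 'I_n.+1 * 'I_n.+1 * K => x 0 t.1.1 - x 0 t.1.2 < c t.2].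
have sgX x y : X x -> X y -> sg x = sg y ->
    connected_component X x = connected_component X y.
  move=> /XP[Vx nx] /XP[Vy ny] sxy; apply: segment_component => t /andP[t0 t1].
  apply/XP; split.
    rewrite /V /sum0_space /=; under eq_bigr do rewrite !mxE.
    rewrite big_split /= -mulr_sumr sumrB.
    by rewrite /V /sum0_space /= in Vx Vy; rewrite Vx Vy subrr mulr0 addr0.
  move=> i j k ij.
  have -> : (x + t *: (y - x)) 0 i - (x + t *: (y - x)) 0 j =
      (x 0 i - x 0 j) + t * ((y 0 i - y 0 j) - (x 0 i - x 0 j)).
    by rewrite !mxE; ring.
  have /= := congr1 (fun f : {ffun _ -> bool} => f (i, j, k)) sxy.
  rewrite !ffunE /=; apply: segment_neq => //; [exact: nx|exact: ny].
pose g b := connected_component X (get [set x | X x /\ sg x = b]).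
apply: (@sub_finite_set _ _ (range g)); last exact/finite_image/finite_finset.
move=> _ [x Xx <-]; exists (sg x) => //; rewrite /g.
have [//|Xy sy] := @getPex _ [set y | X y /\ sg y = sg x].
  by exists x.
by apply: sgX; rewrite // sy.
Qed.

Lemma finite_regions_catalan (m : nat) (a : 'I_m -> R) :
  finite_set (regions (@sum0_space R n.+1) (catalan a (n := n.+1))).
Proof. exact: (@finite_regions_diff _ a). Qed.

Lemma finite_regions_catalan0 (m : nat) (a : 'I_m -> R) :
  finite_set (regions (@sum0_space R n.+1) (catalan0 a (n := n.+1))).
Proof.
apply: (@finite_regions_diff _ (oapp a 0)) => H; split.
- move=> [[i [j [s [ij ->]]]]|[i [j [ij ->]]]].
  + by exists i, j, (Some s).
  + by exists i, j, None.
- move=> [i [j [[s|] [ij ->]]]]; first by left; exists i, j, s.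
  by right; exists i, j.
Qed.

End Finiteness.

(* Main.v *)
(* The symmetric group S_n acts on the regions of C_{n-1} by permuting the
   coordinates.  Adjoining the hyperplanes x_i = x_j cuts a region of C_{n-1}
   into pieces indexed by the coordinate orders it meets.  The stabilizer of the
   region acts simply transitively on these pieces: if two points have the
   same coordinate order and lie in regions of the same orbit, then for each s the
   0/1 matrices [x_i - x_j < a_s] of the two points are monotone with the same
   row sums up to reordering, so they agree.  Hence r(C^0_{n-1}) is the number of
   pairs of a permutation and a region that it fixes.  Regions are convex, so a
   region fixed by a permutation w meets the subspace of points constant on the
   cycles of w, on which C_{n-1} induces C_{k-1} with k the number of cycles
   (x_i - x_j = a_s is empty there when i and j share a cycle, as a_s <> 0).
   This gives the Stirling number formula.

   The series identity is its inversion: the former expands the rising factorials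
   X(X+1)...(X+n-1) into monomials, the latter the monomials into rising
   factorials. *)

Require Import Defs.
From HB Require Import structures.
From mathcomp Require Import all_boot all_order all_algebra all_fingroup finmap.
From mathcomp Require Import ring lra.
From mathcomp Require Import all_classical all_reals all_analysis.

Set Implicit Arguments.
Unset Strict Implicit.
Unset Printing Implicit Defensive.

Import Order.TTheory GRing.Theory Num.Theory.
Import numFieldNormedType.Exports.

Local Open Scope classical_set_scope.
Local Open Scope ring_scope.

(** * Stirling inversion *)

Lemma expg_lift_perm (n : nat) (k : 'I_n.+1) (s : 'S_n) (i : nat) :
  (lift_perm k k s ^+ i)%g = lift_perm k k (s ^+ i)%g.
Proof. by elim: i => [|i IH]; rewrite ?lift_perm1 // !expgS IH lift_permM. Qed.

(** The fixed point [ord0] is a new singleton cycle, and the other cycles are the images under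
    [lift ord0] of those of [s]. *)
Lemma porbits_lift_perm (n : nat) (s : 'S_n) :
  #|porbits (lift_perm ord0 ord0 s)| = #|porbits s|.+1.
Proof.
set L := lift_perm _ _ _.
have L0 : porbit L ord0 = [set ord0]%SET.
  apply/setP => x; rewrite inE; apply/porbitP/eqP => [[i ->]|->].
    by rewrite expg_lift_perm lift_perm_id.
  by exists 0%N; rewrite expg0 perm1.
have Ll j : porbit L (lift ord0 j) = lift ord0 @: porbit s j.
  apply/setP => x; apply/porbitP/imsetP => [[i ->]|[y /porbitP[i ->] ->]].
    by exists ((s ^+ i)%g j); rewrite ?mem_porbit // expg_lift_perm lift_perm_lift.
  by exists i; rewrite expg_lift_perm lift_perm_lift.
have -> : porbits L =
    ([set ord0] |: [set lift ord0 @: (A : {set 'I_n}) | A in porbits s])%SET.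
  apply/setP => A; rewrite in_setU1.
  apply/imsetP/orP => [[x _ ->]|[/eqP ->|/imsetP[_ /imsetP[j _ ->] ->]]].
  - case: (unliftP ord0 x) => [j ->|->]; last by left; rewrite L0.
    by right; rewrite Ll imset_f // imset_f.
  - by exists ord0.
  - by exists (lift ord0 j).
rewrite cardsU1 card_imset; last exact/imset_inj/lift_inj.
rewrite (_ : _ \notin _) //; apply/imsetP => -[A _ /setP/(_ ord0)].
by rewrite set11 => /esym/imsetP[j _ /eqP]; rewrite (negPf (neq_lift _ _)).
Qed.

Lemma porbits_tperm_lift (n : nat) (j : 'I_n.+1) (s : 'S_n) :
  #|porbits (tperm ord0 j * lift_perm ord0 ord0 s)%g| =
  (#|porbits s| + (j == ord0))%N.
Proof.
have := porbits_mul_tperm (lift_perm ord0 ord0 s) ord0 j.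
rewrite /= porbits_lift_perm eq_sym -eq_porbit_mem.
case: (eqVneq j ord0) => [->|j0]; first by rewrite eqxx !addn0 addn1.
suff -> : porbit (lift_perm ord0 ord0 s) ord0 ==
    porbit (lift_perm ord0 ord0 s) j = false.
  by rewrite addn1 addn0 addn2 => -[].
rewrite eq_porbit_mem porbit_sym; apply/negbTE/porbitP => -[i].
by rewrite expg_lift_perm lift_perm_id => /eqP; rewrite (negPf j0).
Qed.

Definition rising (n : nat) : {poly rat} := \prod_(i < n) ('X + i%:R%:P).

Lemma risingS n : rising n.+1 = rising n * ('X + n%:R%:P).
Proof. by rewrite /rising big_ord_recr. Qed.

(* Every permutation of n+1 points is uniquely a transposition (0 j) times a
   permutation fixing 0; a nontrivial (0 j) merges the fixed point 0 into another
   cycle. *)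
Lemma sum_porbits_rising n :
  \sum_(s : 'S_n) 'X^#|porbits s| = rising n.
Proof.
elim: n => [|n IH].
  rewrite /rising big_ord0 (big_pred1 1%g).
    have -> : porbits (1%g : 'S_0) = finset.set0.
      by apply/setP => A; rewrite inE; apply/imsetP => -[[]].
    by rewrite cards0.
  by move=> s; apply/esym/eqP/permP => -[].
pose h (p : 'I_n.+1 * 'S_n) := (tperm ord0 p.1 * lift_perm ord0 ord0 p.2)%g.
have h_inj : injective h.
  move=> [j s] [j' s']; rewrite /h /= => e.
  have jj : j = j'.
    apply: (@perm_inj _ (tperm ord0 j * lift_perm ord0 ord0 s)%g).
    by rewrite {2}e !permM !tpermR !lift_perm_id.
  move: e; rewrite jj => /mulgI e; congr pair; apply/permP => i.
  by apply: (@lift_inj _ ord0); rewrite -!(lift_perm_lift ord0) e.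
have h_bij : bijective h.
  by apply: inj_card_bij h_inj _; rewrite card_prod !card_Sn card_ord factS.
rewrite (reindex h) /=; last exact: onW_bij.
rewrite -(pair_bigA _ (fun j s => 'X^#|porbits (h (j, s))|)) /=.
under eq_bigr do under eq_bigr do rewrite /h /= porbits_tperm_lift.
rewrite big_ord_recl /= risingS -IH mulrDr mulr_suml.
congr (_ + _); first by apply: eq_bigr => s _; rewrite addn1 exprSr.
under eq_bigr do under eq_bigr do rewrite addn0.
by rewrite sumr_const card_ord polyC_natr mulr_natr.
Qed.

Lemma coef_rising n k : (rising n)`_k = (stirling1 n k)%:R.
Proof.
rewrite -sum_porbits_rising coef_sum /stirling1 -sum1_card natr_sum.
rewrite big_mkcond [RHS]big_mkcond; apply: eq_bigr => s _ /=.
by rewrite coefXn inE eq_sym; case: eqP.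
Qed.

Lemma card_porbits_le n (s : 'S_n) : (#|porbits s| <= n)%N.
Proof. by rewrite (leq_trans (leq_imset_card _ _)) // card_ord. Qed.

(** * Powers of 1 - e^{-t} and signed Stirling numbers of the second kind *)

Definition fps_deriv (p : fps) : fps := fun n => n.+1%:R * p n.+1.

Lemma fps_derivM p q n : fps_deriv (fps_mul p q) n =
  fps_mul (fps_deriv p) q n + fps_mul p (fps_deriv q) n.
Proof.
rewrite /fps_deriv /fps_mul mulr_sumr.
have -> : \sum_(i < n.+2) n.+1%:R * (p i * q (n.+1 - i)%N) =
  \sum_(i < n.+2) i%:R * p i * q (n.+1 - i)%N +
  \sum_(i < n.+2) p i * ((n.+1 - i)%:R * q (n.+1 - i)%N).
  rewrite -big_split /=; apply: eq_bigr => i _.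
  by rewrite natrB -1?ltnS //; ring.
congr (_ + _).
  by rewrite big_ord_recl /= !mul0r add0r.
rewrite big_ord_recr /= subnn mul0r mulr0 addr0.
by apply: eq_bigr => i _; rewrite subSn // -ltnS.
Qed.

Lemma fps_mul1 p n : fps_mul fps_one p n = p n.
Proof.
rewrite /fps_mul big_ord_recl big1 ?addr0 ?subn0 ?mul1r // => i _.
by rewrite /fps_one mul0r.
Qed.

Local Notation q1 := (fps_sub fps_one fps_expN).

Lemma fps_deriv_one_sub_expN n : fps_deriv q1 n = fps_one n - q1 n.
Proof.
rewrite /fps_deriv /fps_sub /fps_expN /fps_one opprB subrKC sub0r.
rewrite factS natrM exprS; field; apply/andP; split.
  by rewrite pnatr_eq0 -lt0n fact_gt0.
by rewrite nat1r pnatr_eq0.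
Qed.

Lemma fps_mulBr p q r n :
  fps_mul p (fun i => q i - r i) n = fps_mul p q n - fps_mul p r n.
Proof. by rewrite /fps_mul -sumrB; apply: eq_bigr => i _; rewrite mulrBr. Qed.

(** The series q = 1 - e^{-t} satisfies q' = 1 - q, so (q^k)' = k q^{k-1} (1 - q). For k = 0 the
    junk value [k.-1] is killed by the factor k. *)
Lemma fps_deriv_exp k n :
  fps_deriv (fps_exp q1 k) n = k%:R * (fps_exp q1 k.-1 n - fps_exp q1 k n).
Proof.
elim: k n => [|k IH] n; first by rewrite mul0r /fps_deriv /= mulr0.
have -> : fps_exp q1 k.+1 = fps_mul q1 (fps_exp q1 k) by [].
rewrite fps_derivM.
have -> : fps_mul (fps_deriv q1) (fps_exp q1 k) n =
    fps_exp q1 k n - fps_mul q1 (fps_exp q1 k) n.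
  rewrite -[X in X - _]fps_mul1 /fps_mul -sumrB; apply: eq_bigr => i _.
  by rewrite fps_deriv_one_sub_expN mulrBl.
have -> : fps_mul q1 (fps_deriv (fps_exp q1 k)) n =
    k%:R * (fps_exp q1 k n - fps_mul q1 (fps_exp q1 k) n).
  transitivity
    (k%:R * fps_mul q1 (fun i => fps_exp q1 k.-1 i - fps_exp q1 k i) n).
    rewrite /fps_mul mulr_sumr; apply: eq_bigr => i _.
    by rewrite IH mulrCA.
  by case: k {IH} => [|k]; rewrite ?mul0r // fps_mulBr.
by rewrite -natr1; ring.
Qed.

(* (-1)^(n-k) S(n,k), with S(n,k) a Stirling number of the second kind. *)
Definition sstirling2 (n k : nat) : rat :=
  (n`!)%:R / (k`!)%:R * fps_exp q1 k n.

Lemma sstirling2_0n k : sstirling2 0 k = (k == 0%N)%:R.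
Proof.
case: k => [|k]; first by rewrite /sstirling2 divr1 mul1r.
rewrite /sstirling2 /= /fps_mul big_ord_recl big_ord0 addr0.
by rewrite [q1 0%N]subrr mul0r mulr0.
Qed.

Lemma sstirling2_n0 n : sstirling2 n.+1 0 = 0.
Proof. by rewrite /sstirling2 /= /fps_one mulr0. Qed.

(** Compare the coefficients of t^n in (q^{k+1})' = (k+1)(q^k - q^{k+1}). *)
Lemma sstirling2S n k :
  sstirling2 n.+1 k.+1 = sstirling2 n k - k.+1%:R * sstirling2 n k.+1.
Proof.
have := fps_deriv_exp k.+1 n; rewrite /fps_deriv /sstirling2 /= => e.
have nz i : i`!%:R != 0 :> rat by rewrite pnatr_eq0 -lt0n fact_gt0.
transitivity
  (n`!%:R / (k.+1)`!%:R * (n.+1%:R * fps_mul q1 (fps_exp q1 k) n.+1)).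
  by rewrite [(n.+1)`!]factS natrM; ring.
by rewrite e factS natrM; field; rewrite nz nat1r pnatr_eq0.
Qed.

Lemma sstirling2_gt n k : (n < k)%N -> sstirling2 n k = 0.
Proof.
elim: n k => [|n IH] [|k] //; first by rewrite sstirling2_0n.
by move=> nk; rewrite sstirling2S !IH ?mulr0 ?subr0 // ltnW.
Qed.

(** Induction on n: multiplying by X turns [rising k] into [rising k.+1 - k * rising k], which
    matches the recurrence [sstirling2S]. *)
Lemma rising_expX n : 'X^n = \sum_(k < n.+1) sstirling2 n k *: rising k.
Proof.
elim: n => [|n IH].
  by rewrite big_ord_recl big_ord0 addr0 sstirling2_0n scale1r /rising big_ord0.
rewrite exprS mulrC IH mulr_suml [RHS]big_ord_recl sstirling2_n0 scale0r add0r.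
transitivity (\sum_(k < n.+1) sstirling2 n k *: rising k.+1 -
    \sum_(k < n.+1) (k%:R * sstirling2 n k) *: rising k).
  rewrite -sumrB; apply: eq_bigr => k _.
  rewrite risingS mulrDr scalerDr [rising k * _%:P]mulrC mul_polyC scalerA.
  by rewrite [k%:R * _]mulrC addrK scalerAl.
under [RHS]eq_bigr do rewrite sstirling2S scalerBl.
rewrite sumrB; congr (_ - _).
rewrite [RHS]big_ord_recr /= sstirling2_gt // mulr0 scale0r addr0.
by rewrite big_ord_recl mul0r scale0r add0r.
Qed.

(** The linear functional X^j -> [r j] on polynomials sends [rising k] to [r0 k]. Applying it to the
    expansion of X^n in rising factorials gives the coefficient of t^n, up to the factor n!. *)
Lemma egf_stirling_inversion (r r0 : nat -> nat) :
  (forall n, r0 n = (\sum_(k < n.+1) stirling1 n k * r k)%N) ->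
  egf r =1 fps_comp (egf r0) (fps_sub fps_one fps_expN).
Proof.
move=> r0E n.
have nz i : i`!%:R != 0 :> rat by rewrite pnatr_eq0 -lt0n fact_gt0.
have stirling1_gt i j : (i < j)%N -> stirling1 i j = 0%N.
  move=> ij; apply/eqP; rewrite cards_eq0; apply/eqP/setP => s; rewrite !inE.
  by apply/negbTE; rewrite neq_ltn (leq_ltn_trans (card_porbits_le s) ij).
have r0E' k : (k <= n)%N ->
    (r0 k)%:R = \sum_(j < n.+1) (rising k)`_j * (r j)%:R :> rat.
  move=> kn; rewrite r0E natr_sum (big_ord_widen n.+1
    (fun j => (stirling1 k j * r j)%:R : rat)) // big_mkcond.
  apply: eq_bigr => j _; rewrite coef_rising -natrM; case: ltnP => // kj.
  by rewrite stirling1_gt.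
apply: (mulIf (nz n)); rewrite /egf divfK // /fps_comp mulr_suml.
transitivity (\sum_(k < n.+1) sstirling2 n k * (r0 k)%:R); last first.
  by apply: eq_bigr => k _; rewrite /sstirling2; field; rewrite nz.
transitivity (\sum_(j < n.+1) ('X^n : {poly rat})`_j * (r j)%:R).
  rewrite (bigD1 ord_max) //= coefXn eqxx mul1r big1 ?addr0 // => j.
  by rewrite coefXn -val_eqE /= => /negPf ->; rewrite mul0r.
rewrite rising_expX; under [RHS]eq_bigr => k _.
  by rewrite r0E' 1?mulr_sumr -1?ltnS //; over.
rewrite exchange_big; apply: eq_bigr => j _ /=.
by rewrite coef_sum mulr_suml; apply: eq_bigr => k _; rewrite coefZ mulrA.
Qed.

(** * Regions as sign patterns *)

Section SignPatterns.
Variables (R : realType) (K : finType) (c : K -> R).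

(** No condition is put on the sum of the coordinates, since only their differences matter. *)
Definition generic (n : nat) (x : 'I_n -> R) :=
  forall i j k, i != j -> x i - x j <> c k.

(** The diagonal entries i = j are the same for all points, so they do not affect the count of
    patterns. *)
Definition sgn (n : nat) (x : 'I_n -> R) : {ffun 'I_n * 'I_n * K -> bool} :=
  [ffun t => x t.1.1 - x t.1.2 < c t.2].

Definition patterns n : {set {ffun 'I_n * 'I_n * K -> bool}} :=
  [set b | `[< exists x, generic x /\ sgn x = b >]]%SET.

Lemma patternsP n b :
  reflect (exists x, generic x /\ sgn x = b) (b \in patterns n).
Proof. by rewrite inE; apply: asboolP. Qed.

Section Components.
Variables (n : nat) (C : set (set 'rV[R]_n.+1)).
Hypothesis CP : forall H, C H <-> exists (i j : 'I_n.+1) (k : K),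
  i != j /\ H = diff_hyperplane i j (c k).

Let V := @sum0_space R n.+1.
Let X := arr_compl V C.

Lemma arr_complP x : X x <-> V x /\ generic (x 0).
Proof.
split=> [[Vx nCx]|[Vx nx]]; split=> //.
- move=> i j k ij xij; apply: nCx; exists (diff_hyperplane i j (c k)) => //.
  by apply/CP; exists i, j, k.
- by move=> [H /CP[i [j [k [ij ->]]]] [_ /nx]]; exact.
Qed.

Lemma sgn_component x y : X x -> X y -> sgn (x 0) = sgn (y 0) ->
  connected_component X x = connected_component X y.
Proof.
move=> /arr_complP[Vx nx] /arr_complP[Vy ny] sxy.
apply: segment_component => t /andP[t0 t1].
apply/arr_complP; split.
  rewrite /V /sum0_space /=; under eq_bigr do rewrite !mxE.
  rewrite big_split /= -mulr_sumr sumrB.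
  by rewrite /V /sum0_space /= in Vx Vy; rewrite Vx Vy subrr mulr0 addr0.
move=> i j k ij.
have -> : (x + t *: (y - x)) 0 i - (x + t *: (y - x)) 0 j =
    (x 0 i - x 0 j) + t * ((y 0 i - y 0 j) - (x 0 i - x 0 j)).
  by rewrite !mxE; ring.
have /ffunP/(_ (i, j, k)) := sxy.
by rewrite !ffunE /=; apply: segment_neq => //; [exact: nx|exact: ny].
Qed.

(** A coordinate difference is continuous, so it maps the component onto an interval; this interval
    avoids [c k] and lies on one side of it. *)
Lemma component_sgn x y : X x ->
  connected_component X x y -> sgn (x 0) = sgn (y 0).
Proof.
move=> Xx Xxy; apply/ffunP => -[[i j] k]; rewrite !ffunE /=.
have [->|ij] := eqVneq i j; first by rewrite !subrr.
pose D (z : 'rV[R]_n.+1) : R := z 0 i - z 0 j.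
have Dcont : continuous D.
  by move=> z; apply: (@continuousB _ R^o); exact: coord_continuous.
have /connected_intervalP Dint : connected (D @` connected_component X x).
  apply: connected_continuous_connected; first exact: component_connected.
  exact: continuous_subspaceT.
have Dc z : connected_component X x z -> D z != c k.
  move=> /connected_component_sub/arr_complP[_ nz]; apply/eqP.
  exact: nz.
have DI z z' : connected_component X x z -> connected_component X x z' ->
    D z < c k -> D z' < c k.
  move=> xz xz' zc; rewrite ltNge; apply/negP => z'c.
  have [|w xw /eqP] := Dint (D z) (D z') (imageP _ xz) (imageP _ xz') (c k).
    by rewrite (ltW zc) z'c.
  by rewrite (negPf (Dc _ xw)).
have xx := connected_component_refl Xx.
by apply/idP/idP; apply: DI.
Qed.

(* Recentring a point moves it into V without changing its differences. *)
Lemma patterns_arr_compl b :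
  b \in patterns n.+1 -> exists x, X x /\ sgn (x 0) = b.
Proof.
move=> /patternsP[x [nx <-]].
pose s := (\sum_i x i) / n.+1%:R.
have dE i j : (\row_l (x l - s)) 0 i - (\row_l (x l - s)) 0 j = x i - x j.
  by rewrite !mxE; ring.
exists (\row_i (x i - s)); split; last by apply/ffunP => t; rewrite !ffunE dE.
apply/arr_complP; split; last by move=> i j k ij; rewrite dE; exact: nx.
rewrite /V /sum0_space /=; under eq_bigr do rewrite mxE.
by rewrite sumrB sumr_const card_ord -mulr_natr /s divfK ?subrr //.
Qed.

Lemma num_regions_patterns : num_regions V C = #|patterns n.+1|.
Proof.
pose rep b := get [set x | X x /\ sgn (x 0) = b].
have repP b : b \in patterns n.+1 -> X (rep b) /\ sgn (rep b 0) = b.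
  by move=> /patterns_arr_compl; exact: getPex.
pose g b := connected_component X (rep b).
(* Choosing a representative of each pattern identifies patterns with regions: [sgn_component] gives
   surjectivity, [component_sgn] injectivity. *)
have regE : regions V C = g @` [set` patterns n.+1].
  apply/seteqP; split=> [_ [x Xx <-]|_ [b /repP[Xb _] <-]]; last first.
    by exists (rep b).
  have sb : sgn (x 0) \in patterns n.+1.
    by apply/patternsP; exists (x 0); split => //; case/arr_complP: Xx.
  have [Xr sr] := repP _ sb.
  by exists (sgn (x 0)) => //; apply: sgn_component.
rewrite /num_regions regE fset_set_image; last exact: finite_finset.
rewrite card_in_imfset /=; last first.
  move=> b b'; rewrite !in_fset_set ?inE; try exact: finite_finset.
  move=> /repP[Xb sb] /repP[Xb' sb'] gbb; rewrite -sb -sb'.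
  apply: component_sgn => //; rewrite -/(g b) gbb.
  exact: connected_component_refl.
have -> : fset_set [set` patterns n.+1] = [fset b in enum (patterns n.+1)]%fset.
  apply/fsetP => b; rewrite in_fset_set; last exact: finite_finset.
  by rewrite !inE /= mem_enum mem_setE.
by rewrite card_imfset //= undup_id ?enum_uniq // -cardE.
Qed.

End Components.
End SignPatterns.

Lemma r_catalan_patterns (R : realType) (m : nat) (a : 'I_m -> R) n :
  r_catalan a n = #|patterns a n|.
Proof.
case: n => [|n]; last by apply: num_regions_patterns.
(* For n = 0 the tables have an empty index set, so there is exactly one, in accordance with
   r(C_{-1}) = 1. *)
apply/esym/eqP; rewrite eqn_leq; apply/andP; split.
  by rewrite (leq_trans (max_card _)) // card_ffun !card_prod card_ord expn0.
rewrite card_gt0; apply/set0Pn; exists (sgn a (fun=> 0)); apply/patternsP.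
by exists (fun=> 0); split=> // -[].
Qed.

Lemma r_catalan0_patterns (R : realType) (m : nat) (a : 'I_m -> R) n :
  r_catalan0 a n = #|patterns (oapp a 0) n|.
Proof.
case: n => [|n]; last first.
  apply: num_regions_patterns => H; split.
  - move=> [[i [j [s [ij ->]]]]|[i [j [ij ->]]]].
    + by exists i, j, (Some s).
    + by exists i, j, None.
  - move=> [i [j [[s|] [ij ->]]]]; first by left; exists i, j, s.
    by right; exists i, j.
apply/esym/eqP; rewrite eqn_leq; apply/andP; split.
  by rewrite (leq_trans (max_card _)) // card_ffun !card_prod card_ord expn0.
rewrite card_gt0; apply/set0Pn; exists (sgn (oapp a 0) (fun=> 0)).
by apply/patternsP; exists (fun=> 0); split=> // -[].
Qed.

(** * Fibres over a region of the Catalan arrangement *)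

(* Up-sets of a total preorder form a chain, so they are determined by their
   cardinality. *)
Lemma upset_eq_card (R : realType) (n : nat) (y : 'I_n -> R)
    (A B : {set 'I_n}) :
  (forall i j, y i <= y j -> i \in A -> j \in A) ->
  (forall i j, y i <= y j -> i \in B -> j \in B) ->
  #|A| = #|B| -> A = B.
Proof.
move=> upA upB cAB.
have [AB|/fintype.subsetPn[i iA iB]] := boolP (A \subset B).
  by apply/eqP; rewrite eqEcard AB cAB leqnn.
apply/esym/eqP; rewrite eqEcard cAB leqnn andbT; apply/fintype.subsetP => j jB.
case: (leP (y i) (y j)) => [ij|/ltW ji]; first exact: upA ij iA.
by rewrite (upB _ _ ji jB) in iB.
Qed.

(* The set [t : y_i - y_t < c] is an up-set growing as y_i decreases; its
   cardinality as a function of i is determined up to a permutation, hence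
   determined since its superlevel sets are down-sets for y. *)
Lemma sorted_rows_eq (R : realType) (n : nat) (c : R) (y z : 'I_n -> R)
    (s : 'S_n) :
  (forall i j, (z i <= z j) = (y i <= y j)) ->
  (forall i j, (z i - z j < c) = (y (s i) - y (s j) < c)) ->
  forall i j, (z i - z j < c) = (y i - y j < c).
Proof.
move=> zy zs.
pose D (w : 'I_n -> R) i := [set j | w i - w j < c]%SET.
have Dup w i j l : w j <= w l -> j \in D w i -> l \in D w i.
  by rewrite !inE => jl /(le_lt_trans _); apply; rewrite lerB.
have Danti w i j : w i <= w j -> (#|D w j| <= #|D w i|)%N.
  move=> ij; apply/subset_leq_card/fintype.subsetP => l.
  by rewrite !inE => /(le_lt_trans _); apply; rewrite lerB.
have Ds i : #|D z i| = #|D y (s i)|.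
  rewrite -(card_imset _ (@perm_inj _ s)); apply: eq_card => l.
  rewrite -[l](permKV s) mem_imset ?inE; last exact: perm_inj.
  by rewrite zs permKV.
have Dcard i : #|D z i| = #|D y i|.
  pose S (w : 'I_n -> R) v := [set j | (#|D w j| < v)%N]%SET.
  have SE v : S z v = S y v.
    apply: (@upset_eq_card _ _ y).
    - by move=> j l jl; rewrite !inE; apply: leq_ltn_trans; rewrite Danti // zy.
    - by move=> j l jl; rewrite !inE; apply: leq_ltn_trans; rewrite Danti.
    rewrite -(card_imset _ (@perm_inj _ s)); apply: eq_card => l.
    rewrite -[l](permKV s) mem_imset ?inE; last exact: perm_inj.
    by rewrite Ds permKV.
  apply/eqP; rewrite eqn_leq; apply/andP; split.
  - have := SE #|D y i|.+1 => /setP/(_ i); rewrite !inE !ltnS.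
    by rewrite leqnn => ->.
  - have := SE #|D z i|.+1 => /setP/(_ i); rewrite !inE !ltnS.
    by rewrite leqnn => <-.
move=> i j; have /setP/(_ j) : D z i = D y i.
  apply: (@upset_eq_card _ _ y) => //; last exact: Dup.
  by move=> l l'; rewrite -zy; exact: Dup.
by rewrite !inE.
Qed.

Lemma small_pos (R : realType) (I : finType) (d : I -> R) :
  exists2 e : R, 0 < e & forall i, 0 < d i -> e < d i.
Proof.
exists (\big[Order.min/1]_(i | 0 < d i) (d i / 2)).
  by apply: lt_bigmin => [|i]; [exact: ltr01|lra].
move=> i di; apply: (@le_lt_trans _ _ (d i / 2)); last by lra.
exact: bigmin_le_cond.
Qed.

Definition pat_perm (K : finType) (n : nat) (s : 'S_n)
    (b : {ffun 'I_n * 'I_n * K -> bool}) : {ffun 'I_n * 'I_n * K -> bool} :=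
  [ffun t => b (s t.1.1, s t.1.2, t.2)].

Lemma pat_perm_sgn (R : realType) (K : finType) (c : K -> R) n (s : 'S_n) x :
  pat_perm s (sgn c x) = sgn c (x \o s).
Proof. by apply/ffunP => t; rewrite !ffunE. Qed.

Lemma generic_perm (R : realType) (K : finType) (c : K -> R) n (s : 'S_n) x :
  generic c x -> generic c (x \o s).
Proof. by move=> gx i j k ij; apply: gx; rewrite (inj_eq perm_inj). Qed.

Section Fibres.
Variables (R : realType) (m : nat) (a : 'I_m -> R) (n : nat).

Let a0 : option 'I_m -> R := oapp a 0.

Definition forget (p : {ffun 'I_n * 'I_n * option 'I_m -> bool}) :
    {ffun 'I_n * 'I_n * 'I_m -> bool} := [ffun t => p (t.1, Some t.2)].

Lemma forget_sgn (x : 'I_n -> R) : forget (sgn a0 x) = sgn a x.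
Proof. by apply/ffunP => -[[i j] k]; rewrite !ffunE. Qed.

Lemma generic_forget (x : 'I_n -> R) : generic a0 x -> generic a x.
Proof. by move=> gx i j k; apply: (gx i j (Some k)). Qed.

Lemma generic_inj (x : 'I_n -> R) : generic a0 x -> injective x.
Proof.
move=> gx i j xij; apply/eqP/negP => /negP ij.
by apply: (gx i j None ij); rewrite xij subrr.
Qed.

Lemma generic_perturb (x : 'I_n -> R) : generic a x ->
  exists x', generic a0 x' /\ sgn a x' = sgn a x.
Proof.
move=> gx.
(* Coordinate i is shifted by [e * i]. Differences move by at most [e * n], hence the division by n:
   no nonzero gap changes sign, while ties are broken. *)
have [e e0 eP] := small_pos (fun t : 'I_n * 'I_n * option 'I_m =>
  `|x t.1.1 - x t.1.2 - a0 t.2| / n%:R).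
have eB i j k : x i - x j != a0 k -> `|e * (i%:R - j%:R)| < `|x i - x j - a0 k|.
  move=> ne; have n0 : 0 < n%:R :> R.
    by rewrite ltr0n (leq_ltn_trans _ (ltn_ord i)).
  have := eP (i, j, k); rewrite /= divr_gt0 ?normr_gt0 ?subr_eq0 // => /(_ isT).
  rewrite ltr_pdivlMr //; apply: le_lt_trans.
  rewrite normrM (gtr0_norm e0) ler_pM2l // ler_norml.
  have ? : i%:R <= n%:R :> R by rewrite ler_nat ltnW.
  have ? : j%:R <= n%:R :> R by rewrite ler_nat ltnW.
  have ? : 0 <= i%:R :> R by [].
  have ? : 0 <= j%:R :> R by [].
  by apply/andP; split; lra.
pose x' i := x i + e * i%:R.
have x'E i j : x' i - x' j = x i - x j + e * (i%:R - j%:R) by rewrite /x'; ring.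
exists x'; split.
  move=> i j k ij; rewrite x'E; have [xij|ne] := eqVneq (x i - x j) (a0 k).
    case: k xij => [k /gx|/= ->]; first by move=> /(_ ij).
    rewrite add0r; apply/eqP; apply: mulf_neq0; first by rewrite gt_eqF.
    by rewrite subr_eq0 eqr_nat.
  by move: (eB _ _ _ ne) => + h; rewrite -h opprD addrA subrr sub0r normrN ltxx.
apply/ffunP => -[[i j] k]; rewrite !ffunE /=.
have [->|ij] := eqVneq i j; first by rewrite !subrr.
have ne : x i - x j != a0 (Some k) by apply/eqP; exact: gx.
have := eB _ _ _ ne; rewrite x'E /=.
move: ne => /=; case: (ltgtP (x i - x j) (a k)) => // h _.
  rewrite [X in _ < X]ltr0_norm ?subr_lt0 // ltr_norml => /andP[_ h'].
  by apply/idP; lra.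
rewrite [X in _ < X]gtr0_norm ?subr_gt0 // ltr_norml => /andP[h' _].
by apply/negbTE; rewrite -leNgt; lra.
Qed.

(** Ranking the coordinates turns each point into a permutation; [s] sends an index to the one whose
    rank in x is its rank in y. *)
Lemma sort_perm (x y : 'I_n -> R) : injective x -> injective y ->
  exists s : 'S_n, forall i j, (x (s i) <= x (s j)) = (y i <= y j).
Proof.
have rk (z : 'I_n -> R) : injective z ->
    exists r : 'S_n, forall i j, (z i <= z j) = (r i <= r j)%N.
  move=> zi; have rn i : (#|[set j | (z j < z i)%R]%SET| < n)%N.
    rewrite -[X in (_ < X)%N]card_ord -cardsT; apply: proper_card.
    by apply/fintype.properP; split => //; exists i; rewrite !inE ?ltxx.
  pose r i := Ordinal (rn i).
  have rE i j : (z i <= z j) = (r i <= r j)%N.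
    apply/idP/idP => [ij|]; first apply/subset_leq_card/fintype.subsetP => l.
      by rewrite !inE => /lt_le_trans; apply.
    apply: contraLR; rewrite -ltNge -ltnNge => ji; apply: proper_card.
    apply/fintype.properP; split; last by exists j; rewrite !inE ?ltxx.
    by apply/fintype.subsetP => l; rewrite !inE => /lt_trans; apply.
  have ri : injective r.
    by move=> i j rij; apply: zi; apply/le_anti; rewrite !rE rij leqnn.
  by exists (perm ri) => i j; rewrite !permE rE.
move=> /rk[r rE] /rk[q qE]; exists (q * r^-1)%g => i j.
by rewrite rE qE !permM !permKV.
Qed.

(* The stabilizer of b acts simply transitively on its fibre: the elements of
   the fibre differ by the order they put on the coordinates. *)
Lemma card_fibre b : b \in patterns a n ->
  #|[set p in patterns a0 n | forget p == b]%SET| =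
  #|[set s : 'S_n | pat_perm s b == b]%SET|.
Proof.
move=> /patternsP[x1 [gx1 sb1]].
have [x [gx sx]] := generic_perturb gx1.
have {x1 gx1 sb1 sx} sb : sgn a x = b by rewrite sx.
have xi := generic_inj gx.
pose f s := pat_perm s (sgn a0 x).
(* The action is free: the [None] entries record the order of the coordinates of [x \o s], so
   [x (s i)] and [x (s' i)] have equal rank among the values of x. *)
have fi : injective f.
  move=> s s'; rewrite /f !pat_perm_sgn => e.
  have le i j : (x (s i) <= x (s j)) = (x (s' i) <= x (s' j)).
    move/ffunP/(_ (j, i, None)): e; rewrite !ffunE /= !subr_lt0 => e.
    by rewrite !leNgt e.
  pose D (t : 'S_n) i := [set j | x (t j) <= x (t i)]%SET.
  have cD (t : 'S_n) i : #|D t i| = #|[set l | x l <= x (t i)]%SET|.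
    rewrite -(card_imset _ (@perm_inj _ t)); apply: eq_card => l.
    by rewrite -[l](permKV t) mem_imset ?inE ?permKV //; exact: perm_inj.
  apply/permP => i; apply: xi; apply/le_anti.
  have : [set l | x l <= x (s i)]%SET = [set l | x l <= x (s' i)]%SET.
    (* Lower sets for x are up-sets for its opposite. *)
    apply: (@upset_eq_card _ _ (fun i => - x i)).
    - by move=> j l; rewrite lerN2 !inE; exact: le_trans.
    - by move=> j l; rewrite lerN2 !inE; exact: le_trans.
    by rewrite -!cD; apply: eq_card => j; rewrite !inE le.
  move=> /setP e'; have := e' (s i); have := e' (s' i).
  by rewrite !inE !lexx => -> <-.
rewrite -[RHS](card_imset _ fi); apply: eq_card => p; rewrite !inE.
apply/andP/imsetP => [[/asboolP[y [gy <-]]]|[s]].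
  rewrite forget_sgn => /eqP yb.
  (* Transitivity: [x \o s] has the coordinate order of y and lies in a region of the same orbit, so
     the two patterns agree by [sorted_rows_eq]. *)
  have [s sP] := sort_perm xi (generic_inj gy).
  have sE : sgn a (x \o s) = sgn a y.
    apply/ffunP => -[[i j] k]; rewrite !ffunE /=.
    apply: (@sorted_rows_eq _ _ (a k) y (x \o s) s) => // i' j' /=.
    by move: yb; rewrite -sb => /ffunP/(_ (s i', s j', k)); rewrite !ffunE.
  exists s; first by rewrite inE -sb pat_perm_sgn sE yb sb.
  rewrite /f pat_perm_sgn; apply/ffunP => -[[i j] k]; rewrite !ffunE /=.
  case: k => [k|] /=; last by rewrite !subr_lt0 !ltNge sP.
  by move/ffunP: sE => /(_ (i, j, k)); rewrite !ffunE.
rewrite inE => /eqP sbb ->; rewrite /f pat_perm_sgn; split.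
  by apply/asboolP; exists (x \o s); split => //; exact: generic_perm.
by rewrite forget_sgn -pat_perm_sgn sb sbb.
Qed.

(** Double counting of the pairs of a region and a permutation fixing it, after splitting the
    refined patterns into fibres. *)
Lemma card_patterns0 : #|patterns a0 n| =
  (\sum_(s : 'S_n) #|[set b in patterns a n | pat_perm s b == b]%SET|)%N.
Proof.
rewrite -sum1_card (partition_big forget (mem (patterns a n))) /=; last first.
  move=> p /patternsP[x [gx <-]]; rewrite forget_sgn; apply/patternsP.
  by exists x; split => //; exact: generic_forget.
transitivity (\sum_(b in patterns a n) \sum_(s : 'S_n | pat_perm s b == b) 1)%N.
  apply: eq_bigr => b bP; rewrite sum1dep_card [RHS]sum1dep_card.
  exact: card_fibre.
rewrite (exchange_big_dep xpredT) //=; apply: eq_bigr => s _.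
by rewrite sum1dep_card.
Qed.

End Fibres.

(** * Regions fixed by a permutation *)

Section FixedPatterns.
Variables (R : realType) (m : nat) (a : 'I_m -> R) (n : nat).
Hypothesis a_gt0 : forall s, 0 < a s.

Lemma perm_cycle_map (s : 'S_n) :
  exists f : 'I_n -> 'I_#|porbits s|, exists2 g, cancel g f &
    forall i j, (f i == f j) = (j \in porbit s i).
Proof.
have iP i : porbit s i \in porbits s by exact: imset_f.
(* [enum_rank_in] needs a cycle as witness, and there is none when n = 0. *)
case: n s iP => [|n'] s iP.
  have e : #|porbits s| = 0%N.
    by apply/eqP; rewrite cards_eq0; apply/eqP/setP => A; rewrite inE;
      apply/imsetP => -[[]].
  exists (fun i => cast_ord (esym e) i), (cast_ord e) => [i|[]//].
  exact: cast_ordK.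
pose f i := enum_rank_in (iP ord0) (porbit s i).
have gP (u : 'I_#|porbits s|) : exists i, porbit s i == enum_val u.
  by have /imsetP[i _ ->] := enum_valP u; exists i.
exists f, (fun u => xchoose (gP u)) => [u|i j].
  by rewrite /f (eqP (xchooseP (gP u))) enum_valK_in.
rewrite porbit_sym -eq_porbit_mem.
apply/eqP/eqP => [/(congr1 enum_val)|e]; last by rewrite /f e.
by rewrite !enum_rankK_in.
Qed.

(* Averaging over the powers of s makes a point constant on the cycles of s
   without changing its sign pattern, as regions are convex. *)
Lemma fixed_pattern_average (s : 'S_n) x :
  generic a x -> pat_perm s (sgn a x) = sgn a x ->
  exists w, [/\ generic a w, sgn a w = sgn a x & forall i, w (s i) = w i].
Proof.
move=> gx sx; pose N := #[s]%g.
have N0 : 0 < N%:R :> R by rewrite ltr0n order_gt0.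
have sxX t : sgn a (x \o (s ^+ t)%g) = sgn a x.
  elim: t => [|t IH].
    by apply/ffunP => u; rewrite !ffunE /= !perm1.
  rewrite -[RHS]sx -IH pat_perm_sgn; apply/ffunP => u.
  by rewrite !ffunE /= expgS !permM.
pose w i := (\sum_(t < N) x ((s ^+ t)%g i)) / N%:R.
have wE i j k : i != j -> sgn a x (i, j, k) -> w i - w j < a k.
  move=> ij sij; rewrite /w -mulrBl -sumrB ltr_pdivrMr // mulr_natr.
  have -> : a k *+ N = \sum_(t < N) a k by rewrite sumr_const card_ord.
  apply: ltr_sum; first by apply/hasP; exists (Ordinal (order_gt0 s)).
  by move=> t _; move: sij; rewrite -(sxX t) ffunE.
have wE' i j k : i != j -> ~~ sgn a x (i, j, k) -> a k < w i - w j.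
  move=> ij sij; rewrite /w -mulrBl -sumrB ltr_pdivlMr // mulr_natr.
  have -> : a k *+ N = \sum_(t < N) a k by rewrite sumr_const card_ord.
  apply: ltr_sum; first by apply/hasP; exists (Ordinal (order_gt0 s)).
  move=> t _; move: sij; rewrite -(sxX t) ffunE /= -leNgt le_eqVlt.
  case/orP => // /eqP/esym; case/(generic_perm (s := (s ^+ t)%g) gx ij).
exists w; split.
- move=> i j k ij; apply/eqP; rewrite neq_lt.
  have [sij|sij] := boolP (sgn a x (i, j, k)); first by rewrite wE.
  by rewrite wE' ?orbT.
- apply/ffunP => -[[i j] k]; rewrite [LHS]ffunE /=.
  have [->|ij] := eqVneq i j; first by rewrite ffunE /= !subrr.
  have [sij|sij] := boolP (sgn a x (i, j, k)); first by rewrite wE.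
  by apply/negbTE; rewrite -leNgt ltW // wE'.
- move=> i; congr (_ / _).
  (* Replacing i by [s i] shifts the exponents by one, and the last term wraps around because
     [s ^+ N] is the identity. *)
  have Ns : N = N.-1.+1 by rewrite prednK // order_gt0.
  rewrite Ns big_ord_recr big_ord_recl /= [RHS]addrC; congr (_ + _).
    by apply: eq_bigr => t _; rewrite /= -permM -expgS.
  by rewrite -permM -expgS -Ns expg_order expg0.
Qed.

(** Label the cycles by f. Pulling points back along f identifies points with one coordinate per
    cycle with points constant on cycles, and averaging puts such a point in every fixed region. *)
Lemma card_fixed_patterns (s : 'S_n) :
  #|[set b in patterns a n | pat_perm s b == b]%SET| =
  #|patterns a #|porbits s| |.
Proof.
have [f [g gK fP]] := perm_cycle_map s.
have fs i : f (s i) = f i.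
  by apply/esym/eqP; rewrite fP -{1}(expg1 s) mem_porbit.
pose h (b : {ffun 'I_#|porbits s| * 'I_#|porbits s| * 'I_m -> bool}) :
  {ffun 'I_n * 'I_n * 'I_m -> bool} := [ffun t => b (f t.1.1, f t.1.2, t.2)].
have hi : injective h.
  move=> b b' /ffunP e; apply/ffunP => -[[u v] k].
  by have := e (g u, g v, k); rewrite !ffunE /= !gK.
have hs z : h (sgn a z) = sgn a (z \o f).
  by apply/ffunP => t; rewrite !ffunE.
rewrite -[RHS](card_imset _ hi); apply: eq_card => b; rewrite !inE.
apply/andP/imsetP =>
  [[/asboolP[x [gx <-]] /eqP sx]|[b' /patternsP[z [gz <-]] ->]].
  have [w [gw sw ws]] := fixed_pattern_average gx sx.
  have wX t i : w ((s ^+ t)%g i) = w i.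
    by elim: t => [|t IH]; rewrite ?perm1 // expgSr permM ws.
  have wf : (w \o g) \o f = w.
    apply/funext => i /=; have /porbitP[t ->] : g (f i) \in porbit s i.
      by rewrite -fP gK.
    by rewrite wX.
  exists (sgn a (w \o g)); last by rewrite hs wf.
  apply/patternsP; exists (w \o g); split => // u v k uv.
  by apply: gw; rewrite (can_eq gK).
rewrite hs; split; last first.
  by rewrite pat_perm_sgn; apply/eqP/ffunP => t; rewrite !ffunE /= !fs.
apply/asboolP; exists (z \o f); split => // i j k ij /=.
(* Within a cycle the difference is 0, which is no [a k] by positivity. *)
have [->|fij] := eqVneq (f i) (f j); last exact: gz.
by rewrite subrr => /esym/eqP; rewrite gt_eqF.
Qed.

End FixedPatterns.

Theorem theorem7p1 (R : realType) (m : nat) (a : 'I_m -> R)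
    (a_inj : injective a) (a_gt0 : forall s : 'I_m, 0 < a s) :
  egf (r_catalan a) =1
    fps_comp (egf (r_catalan0 a)) (fps_sub fps_one fps_expN)
  /\
  (forall n : nat,
     r_catalan0 a n = (\sum_(k < n.+1) stirling1 n k * r_catalan a k)%N).
Proof.
suff stirlingE n :
    r_catalan0 a n = (\sum_(k < n.+1) stirling1 n k * r_catalan a k)%N.
  by split => //; exact: egf_stirling_inversion.
rewrite r_catalan0_patterns card_patterns0.
(* Permutations are grouped by their number of cycles, on which alone the number of fixed regions
   depends. *)
pose cyc (s : 'S_n) : 'I_n.+1 := Ordinal (card_porbits_le s : _ < n.+1)%N.
rewrite (partition_big cyc xpredT) //=; apply: eq_bigr => k _.
rewrite r_catalan_patterns /stirling1 -sum_nat_const.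
apply: eq_big => [s|s]; first by rewrite inE.
by move=> /eqP <-; rewrite card_fixed_patterns.
Qed.
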